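(* Let $a \geq 2$ and $k$ be integers. If $(k,a)\neq(0,2)$, then there are infinitely many positive integers $n$ such that $a^{n-k}\equiv 1 \pmod{n}$. If $(k,a)=(0,2)$, then there is no integer $n>1$ such that $a^{n-k}\equiv 1 \pmod n$ (i.e. $2^n \equiv 1 \pmod n$). *)

(* Defs.v *)
From mathcomp Require Import all_boot all_order all_algebra.

Set Implicit Arguments.
Unset Strict Implicit.
Unset Printing Implicit Defensive.

Import Order.TTheory GRing.Theory Num.Theory.
Local Open Scope ring_scope.

(* The congruence a ^ e = c mod n for an exponent e of either sign. For e < 0,
   a ^ e is the (- e)-th power of an inverse b of a modulo n; the congruence is
   false if a has no such inverse. (The power a ^ e of ssrint cannot be used
   for e < 0: its inverse in int is the identity on non-units.) *)
Definition expz_modeq (n a e c : int) : Prop :=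
  match e with
  | Posz m => (a ^+ m = c %[mod n])%Z
  | Negz m => exists2 b : int, (a * b = 1 %[mod n])%Z
                             & (b ^+ m.+1 = c %[mod n])%Z
  end.

(* Main.v *)
(** Write [N = |n - k|] and call [n] a solution when [n] divides [a ^ N - 1].
    If [n] is a solution and [q] is a product of primes modulo which [a] has
    order exactly [N], then [q = 1 + t N], so [n q - k] is a multiple of [N];
    if moreover [q] is coprime to [n], then [n q] is again a solution. Zsigmondy's
    theorem supplies such a [q > 1], and iterating gives infinitely many
    solutions as soon as there is one solution [n] from which the gaps
    [|n - k|] keep growing. When [k > 0] is coprime to [a], the numbers [k p],
    with [p] a primitive prime divisor of [a ^ L - 1] for [L] a multiple of the
    totient of [k], are solutions. In the other cases a starting point is found
    among the divisors of [a - 1] and [a ^ 2 - 1], the primitive part of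
    [a ^ (k - 1) - 1], or, for [a = 2] and [k] even, the values at 2 of the
    cyclotomic polynomials of prime power index [r ^ i] dividing [k - 1];
    finitely many pairs [(a, k)] need an explicit starting point. *)
Require Import Defs.
From Stdlib Require BinNat Nnat.
From mathcomp Require Import all_boot all_order all_algebra.
From mathcomp Require Import cyclic cyclotomic algC.
From mathcomp Require Import classical_sets cardinality.
From mathcomp Require Import zify ring.

Set Implicit Arguments.
Unset Strict Implicit.
Unset Printing Implicit Defensive.

Import Order.TTheory GRing.Theory Num.Theory.
Local Open Scope classical_set_scope.
Local Open Scope ring_scope.

(** * Values of cyclotomic polynomials *)

Definition Phi (a n : nat) : nat := `|('Phi_n).[a%:Z]|%N.

Lemma Phi_prod a n : (0 < a)%N -> (0 < n)%N ->
  (\prod_(d <- divisors n) Phi a d = (a ^ n).-1)%N.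
Proof.
move=> a0 n0; have /(congr1 (fun p => `|p.[a%:Z]|%N)) := prod_Cyclotomic n0.
rewrite horner_prod !hornerE (big_morph absz abszM absz1) => ->.
case: a a0 => // a _.
have : (0 < a.+1 ^ n)%N by rewrite expn_gt0.
have -> : (a.+1%:Z ^+ n = (a.+1 ^ n)%N%:Z) by rewrite -!natz natrX.
by lia.
Qed.

(** [Phi a n] is the modulus of the product of the [totient n] factors [a - z], with [z] a primitive
    [n]-th root of unity, and each factor has modulus between [a - 1] and [a + 1]. *)
Lemma Phi_bounds a n : (0 < a)%N ->
  (a.-1 ^ totient n <= Phi a n <= a.+1 ^ totient n)%N.
Proof.
move=> a0; case: (posnP n) => [->|n0].
  by rewrite /Phi Cyclotomic0 hornerE.
have [z zP] := C_prim_root_exists n0.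
have E : (Phi a n)%:R = `|(cyclotomic z n).[a%:R]| :> algC.
  rewrite -(Cintr_Cyclotomic zP) /Phi -[a%:R]/(a%:~R) horner_map /=.
  by rewrite [LHS]pmulrn abszE intr_norm.
rewrite -!(ler_nat algC) !natrX E /cyclotomic horner_prod normr_prod.
have T : totient n = #|[pred k : 'I_n | coprime k n]|.
  rewrite totient_count_coprime big_mkord -sum1_card [RHS]big_mkcond.
  by apply: eq_bigr => i _; rewrite coprime_sym inE; case: coprime.
have zn k : `|z ^+ k| = 1 :> algC.
  have : `|z ^+ k| ^+ n = 1 by rewrite -normrX exprAC (prim_expr_order zP) expr1n normr1.
  by move/eqP; rewrite pexpr_eq1 // => /eqP.
rewrite T -!prodr_const; apply/andP; split; apply: ler_prod => i _;
  rewrite ?ler0n ?normr_ge0 !hornerE /=.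
  apply: le_trans (lerB_dist _ _); rewrite zn normr_nat.
  by case: a a0 {E} => //= a _; rewrite -natr1 addrK.
by apply: le_trans (ler_normB _ _) _; rewrite zn normr_nat natr1.
Qed.

Lemma Phi_gt0 a n : (1 < a)%N -> (0 < Phi a n)%N.
Proof.
move=> a1; have /andP[+ _] := Phi_bounds n (ltnW a1).
by apply: leq_trans; rewrite expn_gt0; lia.
Qed.

(** Among the factors [Phi a e] of [a ^ n - 1], those with [e] dividing [d] multiply to [a ^ d - 1],
    and [Phi a n] is one of the others. *)
Lemma Phi_mul_dvd a d n : (0 < a)%N -> (0 < n)%N -> (d %| n)%N -> (d < n)%N ->
  ((a ^ d).-1 * Phi a n %| (a ^ n).-1)%N.
Proof.
move=> a0 n0 dn dltn; have d0 : (0 < d)%N by apply: dvdn_gt0 dn.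
rewrite -(Phi_prod a0 n0) (bigID (fun e => e %| d)%N) /=.
rewrite -[X in (_ %| X * _)%N]big_filter /=.
have -> : (\prod_(i <- [seq i <- divisors n | i %| d]) Phi a i =
           \prod_(i <- divisors d) Phi a i)%N.
  apply: perm_big; apply: uniq_perm; rewrite ?filter_uniq ?divisors_uniq // => e.
  rewrite mem_filter -!dvdn_divisors //; case: (boolP (e %| d)%N) => //= ed.
  exact: dvdn_trans dn.
rewrite Phi_prod //; apply: dvdn_mul => //; rewrite (big_rem n) ?divisors_id //=.
by rewrite (gtnNdvd d0 dltn) /=; apply: dvdn_mulr.
Qed.

Lemma Phi_dvd a n : (0 < a)%N -> (0 < n)%N -> (Phi a n %| (a ^ n).-1)%N.
Proof.
move=> a0 n0; rewrite -(Phi_prod a0 n0) (bigD1_seq n) ?divisors_uniq ?divisors_id //=.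
exact: dvdn_mulr.
Qed.

Lemma Phi_dvd_sum a d m : (1 < a)%N -> (0 < d)%N -> (1 < m)%N ->
  (Phi a (d * m) %| \sum_(i < m) (a ^ d) ^ i)%N.
Proof.
move=> a1 d0 m1.
have := @Phi_mul_dvd a d (d * m) (ltnW a1); rewrite muln_gt0 d0 dvdn_mulr // (ltnW m1).
rewrite -[X in (X < _)%N]muln1 ltn_pmul2l // m1 => /(_ isT isT isT).
rewrite expnM (predn_exp (a ^ d)) dvdn_pmul2l //.
by have := ltn_expl d a1; lia.
Qed.

(** * Prime divisors of cyclotomic values *)

Lemma pred_expn_modn a d p : (0 < a)%N -> (p %| (a ^ d).-1)%N = (a ^ d == 1 %[mod p])%N.
Proof.
by move=> a0; rewrite -subn1 -eqn_mod_dvd ?expn_gt0 ?a0.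
Qed.

Lemma pred_expn_gcd a i j p : (0 < a)%N -> (0 < i)%N ->
  (p %| (a ^ i).-1)%N -> (p %| (a ^ j).-1)%N -> (p %| (a ^ gcdn i j).-1)%N.
Proof.
move=> a0 i0; rewrite !pred_expn_modn // => /eqP ei /eqP ej.
have [u v e _] := egcdnP j i0.
have : (a ^ (u * i) = 1 %[mod p])%N by rewrite mulnC expnM -modnXm ei modnXm exp1n.
have hj: (a ^ (v * j) = 1 %[mod p])%N by rewrite mulnC expnM -modnXm ej modnXm exp1n.
by rewrite e expnD -modnMml hj modnMml mul1n => /eqP.
Qed.

Lemma fermat_pred a p j : prime p -> (0 < a)%N -> (0 < j)%N ->
  (p %| (a ^ j).-1)%N -> (p %| (a ^ p.-1).-1)%N.
Proof.
move=> pp a0 j0; rewrite !pred_expn_modn // => /eqP e.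
rewrite -(totient_prime pp); apply/eqP/Euler_exp_totient.
rewrite coprime_sym prime_coprime //; apply/negP => /dvdnP [b ab].
move: e; case: j j0 => // j _; rewrite expnS ab mulnAC modnMl.
by rewrite modn_small ?prime_gt1.
Qed.

Lemma sum_expn_mod x m p : (x = 1 %[mod p])%N -> (\sum_(i < m) x ^ i = m %[mod p])%N.
Proof.
move=> e; elim: m => [|m IH]; first by rewrite big_ord0.
by rewrite big_ord_recr /= -modnDm IH -modnXm e modnXm exp1n modnDm addn1.
Qed.

(** [Phi a n] divides the sum of the first [n / d] powers of [a ^ d], and each of these powers is 1
    modulo [p]. *)
Lemma Phi_prime_quot a n p d : (1 < a)%N -> (0 < n)%N ->
  (p %| Phi a n)%N -> (d %| n)%N -> (d < n)%N -> (p %| (a ^ d).-1)%N ->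
  (p %| n %/ d)%N.
Proof.
move=> a1 n0 pP dn dltn pd; have d0 := dvdn_gt0 n0 dn.
move: pP n0 dltn; rewrite -{1 2 3}(divnK dn) mulnC => pP n0 dltn.
have m1 : (1 < n %/ d)%N by move: dltn; rewrite -[X in (X < _)%N]muln1 ltn_pmul2l.
have := dvdn_trans pP (Phi_dvd_sum a1 d0 m1); rewrite /dvdn.
by rewrite sum_expn_mod //; apply/eqP; rewrite -pred_expn_modn // ltnW.
Qed.

(** By Fermat, [p] divides [a ^ g - 1] for [g = gcd(d, p - 1)]. If a prime [s] divides [n / g], then
    [g] divides [n / s], and [Phi_prime_quot] at [n / s] gives [p = s]. Hence [n / g] is a power of
    [p], nontrivial by the same lemma at [g]. *)
Lemma Phi_prime_shape a n p d : (1 < a)%N -> (0 < n)%N -> prime p ->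
  (p %| Phi a n)%N -> (d %| n)%N -> (d < n)%N -> (p %| (a ^ d).-1)%N ->
  exists i e, [/\ n = (e * p ^ i.+1)%N, (e %| p.-1)%N & (p %| (a ^ e).-1)%N].
Proof.
move=> a1 n0 pp pP dn dltn pd; have d0 := dvdn_gt0 n0 dn.
set g := gcdn d p.-1.
have gn : (g %| n)%N by apply: dvdn_trans dn; apply: dvdn_gcdl.
have g0 : (0 < g)%N by rewrite gcdn_gt0 d0.
have gltn : (g < n)%N by apply: leq_ltn_trans dltn; apply: dvdn_leq (dvdn_gcdl _ _).
have pg : (p %| (a ^ g).-1)%N.
  by apply: pred_expn_gcd => //; [apply: ltnW|apply: fermat_pred pd => //; apply: ltnW].
have pq := Phi_prime_quot a1 n0 pP gn gltn pg.
have q0 : (0 < n %/ g)%N by rewrite divn_gt0 // dvdn_leq.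
have : (p.-nat (n %/ g))%N.
  apply/pnatP => // s sp sq; rewrite inE /=.
  have sgn : (g * s %| n)%N by rewrite -(divnK gn) mulnC dvdn_pmul2r.
  have sn : (s %| n)%N by apply: dvdn_trans sgn; apply: dvdn_mull.
  have gs : (g %| n %/ s)%N by rewrite dvdn_divRL.
  have ns0 : (0 < n %/ s)%N by rewrite divn_gt0 ?prime_gt0 // dvdn_leq.
  have := @Phi_prime_quot a n p (n %/ s) a1 n0 pP (dvdn_div sn).
  rewrite ltn_Pdiv ?prime_gt1 // => /(_ isT).
  have -> : (p %| (a ^ (n %/ s)).-1)%N.
    by apply: dvdn_trans pg _; rewrite -(divnK gs) mulnC expnM dvdn_pred_predX.
  move=> /(_ isT); rewrite divnA // mulKn // dvdn_prime2 // eq_sym.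
  by move/eqP => ->.
move=> /p_natP [[|i] e].
  by move: pq; rewrite e dvdn1 => /eqP p1; rewrite p1 in pp.
exists i, g; split=> //; last exact: dvdn_gcdr.
by rewrite -e mulnC divnK.
Qed.

Lemma sum_expn_1D p y m :
  exists c, (\sum_(j < m) (1 + p * y) ^ j = m + p * y * 'C(m, 2) + p ^ 2 * c)%N.
Proof.
have H j : exists c, ((1 + p * y) ^ j = 1 + j * (p * y) + p ^ 2 * c)%N.
  elim: j => [|j [c IH]]; first by exists 0%N; rewrite expn0; lia.
  exists (c * (1 + p * y) + j * y ^ 2)%N; rewrite expnS IH; ring.
elim: m => [|m [c IH]]; first by exists 0%N; rewrite big_ord0 bin0n; lia.
have [c' E] := H m; exists (c + c')%N.
rewrite big_ord_recr /= IH E binS bin1; ring.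
Qed.

(** Write [n = m p] with [p] dividing [a ^ m - 1]; then [Phi a n] divides the sum of the first [p]
    powers of [a ^ m]. For odd [p] this sum is [p] modulo [p ^ 2], because [p] divides ['C(p, 2)].
    The bound [2 < n] excludes [Phi a 2 = a + 1], which may be a multiple of 4. *)
Lemma Phi_prime_sq a n p d : (1 < a)%N -> (2 < n)%N -> prime p ->
  (p %| Phi a n)%N -> (d %| n)%N -> (d < n)%N -> (p %| (a ^ d).-1)%N ->
  ~~ (p ^ 2 %| Phi a n)%N.
Proof.
move=> a1 n2 pp pP dn dltn pd; have n0 : (0 < n)%N by lia.
have [i [e [En ep pe]]] := Phi_prime_shape a1 n0 pp pP dn dltn pd.
have e0 : (0 < e)%N by case: e En {ep pe} => //; lia.
set m := (e * p ^ i)%N; have m0 : (0 < m)%N by rewrite muln_gt0 e0 expn_gt0 prime_gt0.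
have En' : n = (m * p)%N by rewrite En /m -mulnA -expnSr.
apply/negP; rewrite {1}En' => /dvdn_trans /(_ (Phi_dvd_sum a1 m0 (prime_gt1 pp))).
have am0 : (0 < a ^ m)%N by rewrite expn_gt0 ltnW.
have [y Ey] : exists y, (a ^ m = 1 + p * y)%N.
  have /dvdnP [y yE] : (p %| (a ^ m).-1)%N.
    by apply: dvdn_trans pe _; rewrite /m expnM dvdn_pred_predX.
  by exists y; rewrite mulnC -yE add1n prednK.
have [p2|p_odd] := even_prime pp.
  (* For [p = 2], [n] is a power of 2 above 2, so [m] is even; the square [a ^ m] is not 3 modulo 4,
     so 4 does not divide [1 + a ^ m]. *)
  have {ep}e1 : e = 1%N by move: ep; rewrite p2 dvdn1 => /eqP.
  have i0 : (0 < i)%N by case: i En {En' m m0 am0 Ey} => //; rewrite e1 p2; lia.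
  rewrite p2 !big_ord_recr big_ord0 /= expn0 expn1.
  have [h hE] : exists h, m = (h * 2)%N.
    by exists (2 ^ i.-1)%N; rewrite /m e1 p2 mul1n -expnSr prednK.
  move: Ey; rewrite hE expnM p2 => Ey /dvdnP [w]; rewrite Ey => Ew.
  move: {Ey}Ew (Ey); have := odd_double_half (a ^ h).
  move: (a ^ h)%N (odd _) => t b <-.
  clear; rewrite -mul2n; move: t./2 => {}t; case: b => /=; nia.
rewrite Ey; have [c ->] := sum_expn_1D p y p.
have : (p %| 'C(p, 2))%N.
  by apply: prime_dvd_bin => //; have := prime_gt1 pp; case: (p) p_odd => [|[|[|]]].
case/dvdnP => w ->.
have -> : (p + p * y * (w * p) + p ^ 2 * c = p ^ 2 * (y * w + c) + p)%N by ring.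
rewrite dvdn_addr; last exact: dvdn_mulr.
move=> /(dvdn_leq (prime_gt0 pp)).
by rewrite leqNgt expnS expn1 ltn_Pmulr ?prime_gt1 ?prime_gt0.
Qed.

(** By [Phi_prime_shape], [n = e p ^ (i + 1)] with [e] dividing [p - 1]. A different prime [p'] of
    the same kind divides [n], hence [e], hence is smaller than [p]; the symmetric argument gives a
    contradiction. *)
Lemma Phi_prime_uniq a n p p' d d' : (1 < a)%N -> (0 < n)%N -> prime p -> prime p' ->
  (p %| Phi a n)%N -> (d %| n)%N -> (d < n)%N -> (p %| (a ^ d).-1)%N ->
  (p' %| Phi a n)%N -> (d' %| n)%N -> (d' < n)%N -> (p' %| (a ^ d').-1)%N ->
  p = p'.
Proof.
have W r s i e j f : prime r -> prime s -> (e * r ^ i.+1 = f * s ^ j.+1)%N ->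
    (e %| r.-1)%N -> r <> s -> (s < r)%N.
  move=> rp sp E er rs.
  have : (s %| e * r ^ i.+1)%N by rewrite E expnS mulnCA dvdn_mulr.
  rewrite Euclid_dvdM // => /orP[se|]; last first.
    by rewrite Euclid_dvdX // andbT dvdn_prime2 // => /eqP sr; rewrite sr in rs.
  have r1 := prime_gt1 rp.
  have : (s <= r.-1)%N by apply: dvdn_leq (dvdn_trans se er); rewrite -ltnS prednK // ltnW.
  by rewrite -ltnS prednK // ltnW.
move=> a1 n0 pp pp' pP dn dltn pd pP' dn' dltn' pd'.
have [i [e [En ep pe]]] := Phi_prime_shape a1 n0 pp pP dn dltn pd.
have [j [f [En' fp pf]]] := Phi_prime_shape a1 n0 pp' pP' dn' dltn' pd'.
case: (eqVneq p p') => // /eqP ne.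
have := W _ _ _ _ _ _ pp pp' (etrans (esym En) En') ep ne.
have := W _ _ _ _ _ _ pp' pp (etrans (esym En') En) fp (nesym ne).
by move=> lt1 /(ltn_trans lt1); rewrite ltnn.
Qed.

(* Both sides have the same product over the divisors of [m], namely
   [x ^ (p m) - 1]; strong induction then identifies the factors. *)
Lemma Phi_expn_prime x p m : (1 < x)%N -> prime p -> (0 < m)%N ->
  (Phi (x ^ p) m = Phi x (p * m) * (if ~~ (p %| m) then Phi x m else 1))%N.
Proof.
move=> x1 pp; have p0 := prime_gt0 pp.
have x0 : (0 < x)%N by apply: ltnW.
pose R d := (Phi x (p * d) * (if ~~ (p %| d) then Phi x d else 1))%N.
have prodR k : (0 < k)%N -> (\prod_(d <- divisors k) R d = (x ^ (p * k)).-1)%N.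
  move=> k0; have pk0 : (0 < p * k)%N by rewrite muln_gt0 p0.
  rewrite big_split /= -big_mkcond -(Phi_prod x0 pk0).
  rewrite [RHS](bigID (fun e => p %| e)%N) /=; congr (_ * _)%N.
    rewrite -(big_map (muln p) xpredT (Phi x)) -[RHS]big_filter.
    apply: perm_big; apply: uniq_perm; rewrite ?filter_uniq ?divisors_uniq //.
      by rewrite map_inj_uniq ?divisors_uniq // => u v /eqP; rewrite eqn_pmul2l // => /eqP.
    move=> e; rewrite mem_filter -dvdn_divisors //; apply/mapP/andP => [[d dk ->]|[/dvdnP[d ->]]].
      by rewrite dvdn_mulr // dvdn_pmul2l // dvdn_divisors.
    by rewrite mulnC dvdn_pmul2l // => dk; exists d => //; rewrite -dvdn_divisors.
  rewrite -big_filter -[RHS]big_filter.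
  apply: perm_big; apply: uniq_perm; rewrite ?filter_uniq ?divisors_uniq //.
  move=> e; rewrite !mem_filter -!dvdn_divisors //; case: (boolP (p %| e)%N) => //= pe.
  by rewrite Gauss_dvdr // coprime_sym prime_coprime.
elim/ltn_ind: m => m IH m0; rewrite -/(R m).
have xp1 : (1 < x ^ p)%N by rewrite -(exp1n p) ltn_exp2r.
have := Phi_prod (ltnW xp1) m0; rewrite -expnM -(prodR m m0).
rewrite !(bigD1_seq m) ?divisors_id ?divisors_uniq //=.
have -> : (\prod_(i <- divisors m | i != m) Phi (x ^ p) i =
           \prod_(i <- divisors m | i != m) R i)%N.
  rewrite big_seq_cond [RHS]big_seq_cond; apply: eq_bigr => d.
  rewrite -dvdn_divisors // => /andP[dm ne].
  by rewrite IH //; [rewrite ltn_neqAle ne dvdn_leq|apply: dvdn_gt0 dm].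
move=> /eqP; rewrite eqn_pmul2r => [/eqP //|].
apply: prodn_cond_gt0 => d _; rewrite muln_gt0 Phi_gt0 //=.
by case: ifP => // _; apply: Phi_gt0.
Qed.

(** At base 2 the lower bound of [Phi_bounds] is only 1. Passing to the base [2 ^ p] gives a useful
    bound, at the cost of a factor [Phi 2 m], itself at most [3 ^ totient m]. *)
Lemma Phi_base2_ge p m : prime p -> (0 < m)%N ->
  ((2 ^ p).-1 ^ totient m <=
     Phi 2 (p * m) * (if ~~ (p %| m) then 3 ^ totient m else 1))%N.
Proof.
move=> pp m0; have ppow : (0 < 2 ^ p)%N by rewrite expn_gt0.
have /andP[lo _] := Phi_bounds m ppow.
have /andP[_ hi] := @Phi_bounds 2 m isT.
apply: leq_trans lo _; rewrite Phi_expn_prime // leq_mul2l; apply/orP; right.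
by case: ifP.
Qed.

(** * Lower bounds for cyclotomic values *)

Lemma ltn_linear_exp2 p : (2 < p)%N -> (2 * p + 1 < 2 ^ p)%N.
Proof.
elim: p => // p IH; rewrite ltnS leq_eqVlt => /orP[/eqP <- //|p2].
move: p2 (IH p2); rewrite expnS; move: (2 ^ p)%N; clear; lia.
Qed.

Lemma ltn_exp2_pred p : (2 < p)%N -> (p < 2 ^ p.-1)%N.
Proof.
case: p => // p p2; have := ltn_linear_exp2 p2.
by rewrite expnS /=; move: (2 ^ p)%N; clear; lia.
Qed.

Lemma ltn_pred_exp2 p : (2 < p)%N -> (p < (2 ^ p).-1)%N.
Proof. by move=> p2; have := ltn_linear_exp2 p2; move: (2 ^ p)%N; clear; lia. Qed.

Lemma leq_mul6_exp2 p : (4 < p)%N -> (6 * p <= (2 ^ p).-1)%N.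
Proof.
elim: p => // p IH; rewrite ltnS leq_eqVlt => /orP[/eqP <- //|p4].
move: p4 (IH p4).
rewrite expnS; move: (2 ^ p)%N; lia.
Qed.

(** This ensures that something is left of [Phi a n] after division by its imprimitive prime [p].
    The exception [Phi 2 6 = 3], with [p = 3], is excluded by the hypotheses. For [a > 2] and odd
    [p], [p - 1] divides [totient n], so [Phi a n] is at least [2 ^ (p - 1) > p]. *)
Lemma ltn_Phi a n p d : (1 < a)%N -> (2 < n)%N -> (2 < a)%N || (6 < n)%N ->
  prime p -> (p %| Phi a n)%N -> (d %| n)%N -> (d < n)%N -> (p %| (a ^ d).-1)%N ->
  (p < Phi a n)%N.
Proof.
move=> a1 n2 an pp pP dn dltn pd; have n0 : (0 < n)%N by lia.
have [i [e [En ep pe]]] := Phi_prime_shape a1 n0 pp pP dn dltn pd.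
have e0 : (0 < e)%N by case: e En {ep pe} => //; lia.
have p1 := prime_gt1 pp.
have elt : (e < p)%N.
  rewrite -(prednK (ltnW p1)) ltnS; apply: dvdn_leq ep.
  by rewrite -ltnS (prednK (ltnW p1)).
have [a2|a2] := ltnP 2 a.
  have /andP[+ _] := Phi_bounds n (ltnW a1); apply: leq_trans.
  have [p2|p_odd] := even_prime pp.
    rewrite p2; apply: (@leq_trans (2 ^ 2)) => //.
    apply: (@leq_trans (2 ^ totient n)); first by rewrite leq_exp2l // totient_gt1.
    by rewrite leq_exp2r ?totient_gt0 // -ltnS (prednK (ltnW a1)).
  have p2 : (2 < p)%N by case: (p) pp p_odd => [|[|[|]]].
  apply: leq_trans (ltn_exp2_pred p2) _.
  apply: (@leq_trans (2 ^ totient n)); last by rewrite leq_exp2r ?totient_gt0 // -ltnS (prednK (ltnW a1)).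
  rewrite leq_exp2l // En totient_coprime; last first.
    by rewrite coprimeXr // coprime_sym prime_coprime // gtnNdvd.
  rewrite totient_pfactor //= mulnC -mulnA leq_pmulr //.
  by rewrite muln_gt0 expn_gt0 totient_gt0 e0 (ltnW p1).
have {a1 a2 an}[Ea n6] : a = 2%N /\ (6 < n)%N by lia.
subst a.
have p2 : (2 < p)%N.
  case: (ltngtP p 2) => [|//|p2]; first by lia.
  by move: pe ep; rewrite p2 dvdn1 => + /eqP e1; rewrite e1.
set m := (e * p ^ i)%N.
have m0 : (0 < m)%N by rewrite muln_gt0 e0 expn_gt0 (ltnW p1).
have {}En : n = (p * m)%N by rewrite En /m expnSr; ring.
have t0 : (0 < totient m)%N by rewrite totient_gt0.
have := Phi_base2_ge pp m0; rewrite -En.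
case: ifP => [pm|_].
  (* Since [p] does not divide [m], [n = p e] with [e < p]; thus [p = 3] would force [n <= 6]. *)
  have p5 : (4 < p)%N.
    have i0 : i = 0%N.
      apply/eqP; rewrite -leqn0 leqNgt; apply: contra pm => i0.
      by rewrite /m -(prednK i0) expnS mulnCA dvdn_mulr.
    rewrite ltnNge; apply/negP => p4; move: n6; rewrite En /m i0 expn0 muln1 => n6.
    move: pp p2 p4 elt n6; clear; case: p => [|[|[|[|[|p]]]]] //= _ _ _ elt n6; lia.
  (* The factor 3 is split off to cancel the [3 ^ totient m] of [Phi_base2_ge]. *)
  have big : (3 * (2 * p) <= (2 ^ p).-1)%N by rewrite mulnA; apply: leq_mul6_exp2.
  move=> lo.
  have : ((3 * (2 * p)) ^ totient m <= Phi 2 n * 3 ^ totient m)%N.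
    by apply: leq_trans lo; rewrite leq_exp2r.
  rewrite expnMn mulnC leq_pmul2r ?expn_gt0 //; apply: leq_trans.
  apply: (@leq_trans (2 * p)); first by rewrite ltn_Pmull ?(ltnW p1).
  by rewrite -[X in (X <= _)%N]expn1 leq_pexp2l // muln_gt0 (ltnW p1).
rewrite muln1; apply: leq_trans.
apply: (@leq_trans ((2 ^ p).-1)); first exact: ltn_pred_exp2.
by rewrite -[X in (X <= _)%N]expn1 leq_pexp2l // (leq_trans _ (ltn_pred_exp2 p2)).
Qed.

(** * Primitive prime divisors *)

Lemma prime_divisors_modn q n : (0 < q)%N ->
  (forall p, prime p -> p %| q -> p = 1 %[mod n])%N -> (q = 1 %[mod n])%N.
Proof.
elim/ltn_ind: q => q IH q0 H.
have [q1|q1] := leqP q 1; first by have -> : q = 1%N by lia.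
have pq := pdiv_dvd q; have pp := pdiv_prime q1.
rewrite -(divnK pq) -modnMm (H _ pp pq) (IH (q %/ pdiv q)%N) ?modnMm //.
- by rewrite ltn_Pdiv // prime_gt1.
- by rewrite divn_gt0 ?pdiv_gt0 // pdiv_leq.
- move=> p p_pr pd; exact: H p_pr (dvdn_trans pd (dvdn_div pq)).
Qed.

Lemma Phi_gt1 a n : (1 < a)%N -> (2 < n)%N -> (2 < a)%N || (6 < n)%N -> (1 < Phi a n)%N.
Proof.
move=> a1 n2 an; have n0 : (0 < n)%N by lia.
have [a2|a2] := ltnP 2 a.
  have /andP[+ _] := Phi_bounds n (ltnW a1); apply: leq_trans.
  rewrite -[X in (X < _)%N](expn0 a.-1) ltn_exp2l ?totient_gt0 //; lia.
have {a1 a2 an}[-> n6] : a = 2%N /\ (6 < n)%N by lia.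
(* With [p] odd, [2 ^ p - 1] exceeds 3; with [p] dividing [m], the factor [3 ^ totient m] is absent.
   So [p = 2] is chosen only when 4 divides [n]. *)
have [p [m [pp En pm]]] : exists p m, [/\ prime p, n = (p * m)%N & (2 < p)%N || (p %| m)%N].
  have [n_odd|n_even] := boolP (odd n).
    have pn := pdiv_dvd n; exists (pdiv n), (n %/ pdiv n)%N.
    rewrite pdiv_prime; last by lia.
    by rewrite mulnC divnK // odd_prime_gt2 ?pdiv_prime ?(dvdn_odd pn) //; lia.
  have En : n = (2 * n./2)%N by rewrite mul2n even_halfK.
  have [m_odd|m_even] := boolP (odd n./2); last first.
    by exists 2%N, n./2; rewrite dvdn2 m_even -En.
  have pn : (pdiv n./2 %| n)%N by rewrite {2}En dvdn_mull // pdiv_dvd.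
  exists (pdiv n./2), (n %/ pdiv n./2)%N.
  rewrite mulnC divnK // odd_prime_gt2 ?pdiv_prime ?(dvdn_odd (pdiv_dvd _)) //; lia.
have m0 : (0 < m)%N by case: m En {pm} => //; rewrite muln0 => En; rewrite En in n0.
have t0 : (0 < totient m)%N by rewrite totient_gt0.
have := Phi_base2_ge pp m0; rewrite -En.
have p1 := prime_gt1 pp.
case: ifP => [pnm|_].
  have p2 : (2 < p)%N by case/orP: pm => // pm; rewrite pm in pnm.
  move=> lo; have : (3 ^ totient m < Phi 2 n * 3 ^ totient m)%N.
    by apply: leq_trans lo; rewrite ltn_exp2r // (leq_ltn_trans p2) // ltn_pred_exp2.
  by rewrite -[X in (X < _)%N]mul1n ltn_pmul2r // expn_gt0.
rewrite muln1; apply: leq_trans.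
rewrite -[X in (X < _)%N](exp1n (totient m)) ltn_exp2r //.
by apply: leq_trans p1 _; have := ltn_expl p (isT : 1 < 2)%N; case: (2 ^ p)%N.
Qed.

(* Zsigmondy's theorem, with all primitive primes collected in one divisor [q]
   so as to retain a lower bound for its size. *)
Lemma primitive_part a n : (1 < a)%N -> (2 < n)%N -> (2 < a)%N || (6 < n)%N ->
  exists q, [/\ (1 < q)%N, (q %| (a ^ n).-1)%N, (a.-1 ^ totient n <= q * n)%N &
    forall p j, prime p -> (p %| q)%N -> (0 < j)%N -> (p %| (a ^ j).-1)%N -> (n %| j)%N].
Proof.
move=> a1 n2 an; have n0 : (0 < n)%N by lia.
have P0 := Phi_gt0 n a1.
have /andP[lo _] := Phi_bounds n (ltnW a1).
pose bad p := has (fun d => (d < n)%N && (p %| (a ^ d).-1)%N) (divisors n).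
have badP p : reflect (exists d, [/\ d %| n, d < n & p %| (a ^ d).-1])%N (bad p).
  apply: (iffP hasP) => [[d] | [d [dn dltn pd]]].
    by rewrite -dvdn_divisors // => dn /andP[]; exists d.
  by exists d; rewrite -?dvdn_divisors // dltn pd.
have good p j : prime p -> (p %| Phi a n)%N -> ~~ bad p -> (0 < j)%N ->
    (p %| (a ^ j).-1)%N -> (n %| j)%N.
  move=> pp pP gp j0 pj; apply/idPn => nj; case/negP: gp; apply/badP.
  exists (gcdn j n); split; first exact: dvdn_gcdr.
    rewrite ltn_neqAle dvdn_leq ?dvdn_gcdr // andbT; apply: contra nj => /eqP <-.
    exact: dvdn_gcdl.
  by apply: pred_expn_gcd => //; [apply: ltnW|apply: dvdn_trans pP (Phi_dvd _ _); lia].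
(* If no prime is bad, [q] is [Phi a n]. Otherwise there is one bad prime [p], which occurs once,
   and [q] is [Phi a n / p]; as [p] divides [n], this loses at most the factor [n] in the size
   bound. *)
have [/hasP[p] | /hasPn allgood] := boolP (has bad (primes (Phi a n))); last first.
  exists (Phi a n); split; first exact: Phi_gt1.
  - by apply: Phi_dvd => //; apply: ltnW.
  - by apply: leq_trans lo _; rewrite leq_pmulr.
  - move=> p j pp pP; apply: good => //; apply: allgood.
    by rewrite mem_primes pp P0.
rewrite mem_primes => /and3P[pp _ pP] /badP[d [dn dltn pd]].
have p_lt := ltn_Phi a1 n2 an pp pP dn dltn pd.
have p_le : (p <= n)%N.
  apply: dvdn_leq => //.
  exact: dvdn_trans (Phi_prime_quot a1 n0 pP dn dltn pd) (dvdn_div dn).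
have E := divnK pP.
exists (Phi a n %/ p)%N; split.
- by move: p_lt; rewrite -{1}E -[X in (X < _)%N]mul1n ltn_pmul2r // prime_gt0.
- by apply: dvdn_trans (Phi_dvd (ltnW a1) n0); apply: dvdn_div.
- by apply: leq_trans lo _; rewrite -{1}E leq_mul2l p_le orbT.
move=> s j sp sq; have sP := dvdn_trans sq (dvdn_div pP).
apply: good => //; apply/badP => -[d' [dn' dltn' sd]].
have es := Phi_prime_uniq a1 n0 pp sp pP dn dltn pd sP dn' dltn' sd.
case/negP: (Phi_prime_sq a1 n2 pp pP dn dltn pd).
by rewrite -E expnS expn1 dvdn_pmul2r ?prime_gt0 // {1}es.
Qed.

Lemma primitive_part_modn a n q : (1 < a)%N -> (0 < q)%N -> (q %| (a ^ n).-1)%N ->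
  (0 < n)%N ->
  (forall p j, prime p -> (p %| q)%N -> (0 < j)%N -> (p %| (a ^ j).-1)%N -> (n %| j)%N) ->
  (q = 1 %[mod n])%N.
Proof.
move=> a1 q0 qa n0 ord; apply: prime_divisors_modn => // p pp pq.
have p1 := prime_gt1 pp.
have : (n %| p.-1)%N.
  apply: (ord p p.-1 pp pq); first by lia.
  by apply: (fermat_pred pp _ n0); [apply: ltnW | apply: dvdn_trans pq qa].
by case/dvdnP => t pE; rewrite -(prednK (ltnW p1)) pE -addn1 modnMDl.
Qed.

(** * Growing a solution *)

Definition gap (k : int) (n : nat) : nat := `|n%:Z - k|%N.

(* The last clause makes the gap grow when [n] is multiplied by a primitive part
   of [(a ^ gap k n).-1]. *)
Definition seed (a : nat) (k : int) (n : nat) : Prop :=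
  [/\ (0 < n)%N,
      exists j, [/\ (0 < j)%N, (j < gap k n)%N, (j %| gap k n)%N & (n %| (a ^ j).-1)%N],
      (2 < gap k n)%N, (2 < a)%N || (6 < gap k n)%N &
      [\/ k < n%:Z, (2 < n)%N | [/\ n = 2%N, odd a & odd `|k|%N]]].

(** This is why a seed carries a proper divisor [j] of its gap: a common prime of [n] and [q] would
    divide [a ^ j - 1], although [a] has order [N > j] modulo it. *)
Lemma primitive_part_coprime a N q j n : (0 < j)%N -> (j < N)%N -> (n %| (a ^ j).-1)%N ->
  (0 < n)%N ->
  (forall p j, prime p -> (p %| q)%N -> (0 < j)%N -> (p %| (a ^ j).-1)%N -> (N %| j)%N) ->
  coprime n q.
Proof.
move=> j0 jN nj n0 ord; have g0 : (0 < gcdn n q)%N by rewrite gcdn_gt0 n0.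
rewrite /coprime eqn_leq g0 andbT leqNgt; apply/negP => g1.
have pg := pdiv_dvd (gcdn n q).
have pn := dvdn_trans pg (dvdn_gcdl n q); have pq := dvdn_trans pg (dvdn_gcdr n q).
have := ord _ j (pdiv_prime g1) pq j0 (dvdn_trans pn nj).
by move/(dvdn_leq j0); rewrite leqNgt jN.
Qed.

(** With [q = 1 + t N], the gap of [n q] is [(n t + 1) N] if [k < n], and [(n t - 1) N] otherwise.
    The old gap [N] then serves as the exponent [j] of the new seed. *)
Lemma seed_step a k n : (1 < a)%N -> seed a k n ->
  exists2 n', (n < n')%N & seed a k n'.
Proof.
move=> a1 [n0 [j [j0 jN jdvd nj]] N2 aN grow]; set N := gap k n in jN jdvd N2 aN.
have N0 : (0 < N)%N by lia.
have [q [q1 qN _ ord]] := primitive_part a1 N2 aN.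
have cop := primitive_part_coprime j0 jN nj n0 ord.
have := primitive_part_modn a1 (ltnW q1) qN N0 ord.
move=> /eqP; rewrite eqn_mod_dvd ?(ltnW q1) // => /dvdnP [t qE].
have {}qE : q = (1 + t * N)%N by rewrite -qE subnKC // ltnW.
have t0 : (0 < t)%N by case: t qE => // qE; rewrite qE in q1.
have [s [s1 gapE]] : exists s, (1 < s)%N /\ gap k (n * q) = (s * N)%N.
  have [kn|nk] := boolP (k < n%:Z).
    exists (n * t + 1)%N; split; first by rewrite addn1 ltnS muln_gt0 n0.
    have NE : n%:Z - k = N%:Z by rewrite /N /gap; lia.
    suff : (n * q)%N%:Z - k = ((n * t + 1) * N)%N%:Z by rewrite /gap => ->.
    rewrite qE !(PoszD, PoszM); move: (N) NE => M NE.
    have -> : k = n%:Z - M%:Z by rewrite -NE; ring.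
    by ring.
  have NE : k - n%:Z = N%:Z by rewrite /N /gap; lia.
  (* Only [n = 2], [t = 1] is delicate: there [N = k - 2] is odd and [q = 1 + N] is even, but 2
     divides [a - 1], which would force [N = 1]. *)
  have nt : (2 < n * t)%N.
    case: grow => [kn | n3 | [n2 a_odd k_odd]]; first by rewrite kn in nk.
      by apply: leq_trans n3 _; rewrite leq_pmulr.
    rewrite n2 mul2n -addnn; suff : t != 1%N by lia.
    apply/eqP => t1; move: qE; rewrite t1 mul1n => qE.
    have : (2 %| q)%N.
      rewrite dvdn2 qE oddD /= negbK; rewrite n2 in NE.
      by move: NE k_odd; clear; lia.
    move=> q2; have := ord 2%N 1%N isT q2 isT.
    rewrite expn1 -n2 -subn1 n2 dvdn2 oddB ?a_odd ?(ltnW a1) //= => /(_ isT).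
    by rewrite dvdn1 => /eqP N1; rewrite N1 in N2.
  exists (n * t - 1)%N; split; first by rewrite ltn_subRL.
  suff : k - (n * q)%N%:Z = - ((n * t - 1) * N)%N%:Z by rewrite /gap -abszN opprB => ->;
    rewrite abszN.
  rewrite qE !PoszM -subzn; last by rewrite ltnW // ltnW.
  move: (N) NE => M NE; have -> : k = n%:Z + M%:Z by rewrite -NE; ring.
  by rewrite !(PoszD, PoszM); ring.
have NsN : (N < gap k (n * q))%N by rewrite gapE -[X in (X < _)%N]mul1n ltn_pmul2r.
exists (n * q)%N; first by rewrite -[X in (X < _)%N]muln1 ltn_pmul2l.
split.
- by rewrite muln_gt0 n0 ltnW.
- exists N; split=> //; first by rewrite gapE dvdn_mull.
  rewrite Gauss_dvd // qN andbT; apply: dvdn_trans nj _.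
  by case/dvdnP: jdvd => u ->; rewrite mulnC expnM dvdn_pred_predX.
- exact: ltn_trans NsN.
- by case/orP: aN => [->|N6] //; rewrite (ltn_trans N6) ?orbT.
case: grow => [kn | n3 | [n2 _ _]].
- apply: Or31; apply: lt_le_trans kn _; rewrite lez_nat leq_pmulr //.
  exact: ltnW.
- by apply: Or32; apply: leq_trans n3 _; rewrite leq_pmulr // ltnW.
- by apply: Or32; rewrite n2 mul2n -addnn; lia.
Qed.

Definition solution (a : nat) (k : int) (n : nat) : Prop :=
  (0 < n)%N /\ (n %| (a ^ gap k n).-1)%N.

Lemma seed_solutions a k n B : (1 < a)%N -> seed a k n ->
  exists2 m, (B < m)%N & solution a k m.
Proof.
move=> a1 sn; have [m Bm sm] : exists2 m, (B < m)%N & seed a k m.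
  elim: B => [|B [m Bm sm]]; first by exists n => //; case: sn.
  by have [m' mm' sm'] := seed_step a1 sm; exists m' => //; apply: leq_ltn_trans mm'.
exists m => //; case: sm => m0 [j [_ _ /dvdnP[u gE] mj]] _ _ _; split=> //.
by apply: dvdn_trans mj _; rewrite gE mulnC expnM dvdn_pred_predX.
Qed.

Lemma coprime_solutions a k B : (1 < a)%N -> (0 < k)%N -> coprime a k ->
  exists2 m, (B < m)%N & solution a k%:Z m.
Proof.
move=> a1 k0 ak; set L := (totient k * (B + k + 7))%N.
(* A primitive prime [p] is 1 modulo [L], so [totient k] divides [p - 1]. The second factor of [L]
   makes [p] exceed [B] and [k], and puts [L] above 6 as Zsigmondy's theorem requires for
   [a = 2]. *)
have t0 : (0 < totient k)%N by rewrite totient_gt0.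
have Lge : (B + k + 7 <= L)%N by rewrite leq_pmull.
have L6 : (6 < L)%N by apply: leq_trans Lge; lia.
have L2 : (2 < L)%N by apply: ltn_trans L6.
have [q [q1 qL _ ord]] := primitive_part a1 L2 (introT orP (or_intror L6)).
have pp := pdiv_prime q1; set p := pdiv q in pp.
have p1 := prime_gt1 pp.
have pq : (p %| q)%N by apply: pdiv_dvd.
have pL : (p %| (a ^ L).-1)%N by apply: dvdn_trans qL.
have L0 : (0 < L)%N by apply: ltn_trans L6.
have pa : (p %| (a ^ p.-1).-1)%N by apply: fermat_pred pL => //; apply: ltnW.
have p10 : (0 < p.-1)%N by rewrite -ltnS prednK // ltnW.
have Lp := ord p p.-1 pp pq p10 pa.
have Llt : (L < p)%N by have := dvdn_leq p10 Lp; rewrite -ltnS prednK // ltnW.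
have Bkp : (B + k + 7 < p)%N by apply: leq_ltn_trans Lge Llt.
exists (k * p)%N.
  apply: (@leq_trans p); last by rewrite leq_pmull.
  by apply: leq_trans Bkp; rewrite ltnS -addnA leq_addr.
split; first by rewrite muln_gt0 k0 ltnW.
have -> : gap k (k * p) = (k * p.-1)%N.
  by rewrite /gap; rewrite -{1}(prednK (ltnW p1)) mulnS PoszD addrC addKr.
rewrite Gauss_dvd; last first.
  rewrite coprime_sym prime_coprime // gtnNdvd //; apply: leq_ltn_trans Bkp.
  by rewrite addnAC leq_addl.
have kt : (k %| (a ^ totient k).-1)%N.
  by rewrite pred_expn_modn ?(ltnW a1) //; apply/eqP/Euler_exp_totient.
apply/andP; split; last by apply: dvdn_trans pa _; rewrite mulnC expnM dvdn_pred_predX.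
have : (totient k %| k * p.-1)%N.
  by apply: dvdn_mull; apply: dvdn_trans Lp; rewrite /L dvdn_mulr.
by case/dvdnP => u ->; apply: dvdn_trans kt _; rewrite mulnC expnM dvdn_pred_predX.
Qed.

(** * Starting points *)

(* Binary arithmetic keeps the explicit verifications cheap. *)
Definition power_test (a j n : nat) : bool :=
  let x := iter j (BinNat.N.mul (BinNat.N.of_nat a)) BinNat.N.one in
  let m := BinNat.N.of_nat n in
  BinNat.N.eqb (BinNat.N.add (BinNat.N.mul m (BinNat.N.div x m)) BinNat.N.one) x.

Lemma dvdn_power_test a j n : power_test a j n -> (n %| (a ^ j).-1)%N.
Proof.
rewrite /power_test => /BinNat.N.eqb_eq /(congr1 BinNat.N.to_nat).
rewrite Nnat.N2Nat.inj_add Nnat.N2Nat.inj_mul Nnat.Nat2N.id plusE multE.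
have -> : BinNat.N.to_nat (iter j (BinNat.N.mul (BinNat.N.of_nat a)) BinNat.N.one) = (a ^ j)%N.
  by elim: j => //= j IH; rewrite Nnat.N2Nat.inj_mul IH Nnat.Nat2N.id multE expnS.
by move=> <-; rewrite addn1 /= dvdn_mulr.
Qed.

Lemma seed_intro a k n j m : (0 < a)%N -> (1 < n)%N -> gap k n = (m * j)%N ->
  (0 < j)%N -> (1 < m)%N -> (2 < gap k n)%N -> (2 < a)%N || (6 < gap k n)%N ->
  (n %| (a ^ j).-1)%N ->
  [\/ k < n%:Z, (2 < n)%N | [/\ n = 2%N, odd a & odd `|k|%N]] -> seed a k n.
Proof.
move=> a0 n1 gE j0 m1 g2 ag nj grow; split=> //; first exact: ltnW.
exists j; split=> //; last by rewrite gE dvdn_mull.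
by rewrite gE -[X in (X < _)%N]mul1n ltn_pmul2r.
Qed.

Lemma seed_of_order1 a k n : (2 < a)%N -> (1 < n)%N -> (n %| a.-1)%N -> (2 < gap k n)%N ->
  [\/ k < n%:Z, (2 < n)%N | [/\ n = 2%N, odd a & odd `|k|%N]] -> seed a k n.
Proof.
move=> a2 n1 na g2; apply: (@seed_intro a k n 1 (gap k n)) => //; rewrite ?a2 ?muln1 //.
- exact: ltn_trans a2.
- exact: ltn_trans g2.
Qed.

(** The residues 1, 2 and [n - 1] are distinct and coprime to [n]. *)
Lemma totient_odd_gt2 n : (4 < n)%N -> odd n -> (2 < totient n)%N.
Proof.
case: n => [|[|[|[|n]]]] // n0 n_odd; rewrite totient_count_coprime.
rewrite big_nat_recr //= 3?big_ltn // coprimen1 coprimen2 n_odd (coprimeSn n.+3).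
by move: (coprime _ 0) (\sum_(_ <= _ < _) _)%N; clear; lia.
Qed.

(** The primitive part is [q = 1 + t N], so its gap from [N + 1] is [(t - 1) N], and [N] is a proper
    divisor of it once [t > 2]. If [t <= 2], the size bound gives [(a - 1) ^ 3 <= q N <= (1 + 2 (a -
    1)) (a - 1)], false for such [a]. *)
Lemma seed_of_primitive a N : (2 < a)%N -> odd N -> (4 < N)%N -> (N < a)%N ->
  exists q, seed a N.+1%:Z q.
Proof.
move=> a2 N_odd N4 Na; have a1 : (1 < a)%N by lia.
have N2 : (2 < N)%N by lia.
have [|q [q1 qN big ord]] := primitive_part a1 N2; first by rewrite a2.
have := primitive_part_modn a1 (ltnW q1) qN (ltnW (ltnW N2)) ord.
move=> /eqP; rewrite eqn_mod_dvd ?(ltnW q1) // => /dvdnP [t qE].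
have {}qE : q = (1 + t * N)%N by rewrite -qE subnKC // ltnW.
have t2 : (2 < t)%N.
  rewrite ltnNge; apply/negP => t2.
  have b1 : (a.-1 ^ 3 <= q * N)%N.
    apply: leq_trans big; apply: leq_pexp2l; first by lia.
    exact: totient_odd_gt2.
  have b2 : (q * N <= (1 + 2 * a.-1) * a.-1)%N.
    by rewrite qE leq_mul ?leq_add2l ?leq_mul //; lia.
  have := leq_trans b1 b2; case: (a) a2 => // b b2'.
  by rewrite /= expnSr leq_pmul2r; [rewrite -mulnn; nia|lia].
have gE : gap N.+1%:Z q = (t.-1 * N)%N.
  rewrite /gap qE; case: t {qE} t2 => // t _ /=; rewrite mulSn; lia.
exists q; apply: (@seed_intro _ _ _ N t.-1) => //; rewrite ?gE ?a2 //.
- by lia.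
- by lia.
- by lia.
- by rewrite (leq_trans N2) // leq_pmull //; lia.
apply: Or32; rewrite qE; nia.
Qed.

Lemma Phi_prime a p : (0 < a)%N -> prime p -> (a.-1 * Phi a p)%N = (a ^ p).-1.
Proof.
move=> a0 pp; rewrite -(Phi_prod a0 (prime_gt0 pp)).
have := Phi_prod a0 (isT : 0 < 1)%N; rewrite big_cons big_nil muln1 expn1 => <-.
have -> : (\prod_(d <- divisors p) Phi a d = \prod_(d <- [:: 1; p]) Phi a d)%N.
  apply: perm_big; apply: uniq_perm; rewrite ?divisors_uniq //=.
    by rewrite inE eq_sym neq_ltn prime_gt1 // orbT.
  move=> d; rewrite -dvdn_divisors ?prime_gt0 // !inE.
  by case/primeP: pp => p1 /(_ d) H; apply/idP/orP => [/H /orP // | [] /eqP -> //]; rewrite dvd1n.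
by rewrite 2!big_cons big_nil muln1.
Qed.

(** The sharper bound shows that the gap differs from [M] when [k = M + 1]. It fails for [M = 3],
    where [Phi 2 3 = 7]. *)
Lemma Phi_base2_prime_power r i (M := (r ^ i.+1)%N) : prime r -> (2 < r)%N ->
  (2 * M < Phi 2 M)%N /\ ((4 < M)%N -> (2 * M + 1 < Phi 2 M)%N).
Proof.
move=> pr r2; suff H : (4 < M)%N -> (2 * M + 1 < Phi 2 M)%N.
  split=> //; have [/H|M4] := ltnP 4 M; first by rewrite addn1; apply: ltnW.
  have rM : (r <= M)%N by rewrite -[X in (X <= _)%N]expn1 leq_pexp2l // prime_gt0.
  have r3 : r = 3%N by case: (r) pr r2 (leq_trans rM M4) => [|[|[|[|[|]]]]].
  have ME : M = 3%N.
    move: M4; rewrite /M r3; case: (i) => // i'; rewrite expnS (expnS 3 i').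
    by have := expn_gt0 3 i'; lia.
  by rewrite ME -[Phi 2 3]mul1n (@Phi_prime 2 3).
rewrite /M; case: i @M => [|i] M M4.
  have r4 : (4 < r)%N by move: M4; rewrite /M expn1.
  rewrite expn1 -[Phi 2 r]mul1n (@Phi_prime 2 r) //.
  by apply: leq_trans (leq_mul6_exp2 r4); move: r4; clear; lia.
have m0 : (0 < r ^ i.+1)%N by rewrite expn_gt0 prime_gt0.
have := Phi_base2_ge pr m0; rewrite -expnS -/M dvdn_exp //= muln1; apply: leq_trans.
have b : (2 * r + 1 <= (2 ^ r).-1)%N.
  by have := ltn_linear_exp2 r2; move: (2 ^ r)%N; clear; lia.
apply: (@leq_trans ((2 * r + 1) ^ totient (r ^ i.+1))); last first.
  by rewrite leq_exp2r // totient_gt0.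
apply: (@leq_trans ((2 * r + 1) ^ i.+2)); last first.
  rewrite leq_pexp2l ?addn1 // totient_pfactor //=.
  apply: leq_trans (ltn_expl i.+1 (isT : 1 < 2)%N) _; rewrite expnS.
  apply: leq_mul; first by move: r2; clear; lia.
  by case: (i) => // i'; rewrite leq_exp2r // ltnW.
have c : (r ^ i.+1 <= (2 * r + 1) ^ i.+1)%N by rewrite leq_exp2r //; move: r2; clear; lia.
rewrite expnS; apply: leq_trans (leq_mul (leqnn _) c).
rewrite /M [in X in (X < _)%N]expnS mulnDl mul1n mulnA ltn_add2l.
by apply: leq_trans (ltn_expl _ (ltnW r2)).
Qed.

(** Both [Phi 2 M] and [k] are 1 modulo [M], so the gap is [u M]. It is odd because [k] is even, so
    [u] is odd, and [u = 1] is excluded by hypothesis. *)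
Lemma seed_base2_prime_power k r i : (r ^ i.+1 %| k.-1)%N -> prime r -> (2 < r)%N ->
  ~~ odd k -> (4 < k)%N -> gap k%:Z (Phi 2 (r ^ i.+1)) <> (r ^ i.+1)%N ->
  seed 2 k%:Z (Phi 2 (r ^ i.+1)).
Proof.
move=> Mk pr r2 k_even k4; set M := (r ^ i.+1)%N => gap_ne.
have M2 : (2 < M)%N.
  by apply: leq_trans r2 _; rewrite -[X in (X <= _)%N]expn1 leq_pexp2l // prime_gt0.
have M0 : (0 < M)%N by lia.
have r_odd : odd r by case: (even_prime pr) r2 => [->|].
have M_odd : odd M by rewrite oddX r_odd orbT.
have P0 : (0 < Phi 2 M)%N by apply: Phi_gt0.
(* All primes of [Phi 2 M] are primitive: by [Phi_prime_shape] an imprimitive one would be [r] with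
   [e = 1], and would divide [2 ^ 1 - 1]. *)
have ord p j : prime p -> (p %| Phi 2 M)%N -> (0 < j)%N -> (p %| (2 ^ j).-1)%N -> (M %| j)%N.
  move=> pp pP j0 pj; apply/idPn => Mj.
  have dltM : (gcdn j M < M)%N.
    rewrite ltn_neqAle dvdn_leq ?dvdn_gcdr // andbT; apply: contra Mj => /eqP <-.
    exact: dvdn_gcdl.
  have pd : (p %| (2 ^ gcdn j M).-1)%N.
    by apply: pred_expn_gcd => //; apply: dvdn_trans pP (Phi_dvd _ _).
  have [e0 [e [E ep pe]]] := Phi_prime_shape (isT : 1 < 2)%N M0 pp pP (dvdn_gcdr _ _) dltM pd.
  have pr' : p = r.
    have : (p %| r ^ i.+1)%N by rewrite -/M E expnS mulnCA dvdn_mulr.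
    by rewrite Euclid_dvdX // andbT dvdn_prime2 // => /eqP.
  have e1 : e = 1%N.
    have : coprime e (r ^ i.+1).
      rewrite coprimeXr // coprime_sym prime_coprime // gtnNdvd //.
        by case: e E {ep pe} => // E; rewrite E in M0.
      have p1 : (0 < p.-1)%N by rewrite -ltnS (prednK (prime_gt0 pp)) prime_gt1.
      by rewrite -pr' -(prednK (prime_gt0 pp)) ltnS dvdn_leq.
    by rewrite -/M E coprimeMr {1}/coprime gcdnn => /andP[/eqP].
  by move: pe; rewrite e1 dvdn1 => /eqP p1; rewrite p1 in pp.
have PM : (Phi 2 M %| (2 ^ M).-1)%N by apply: Phi_dvd.
have := primitive_part_modn (isT : 1 < 2)%N P0 PM M0 ord.
move=> /eqP; rewrite eqn_mod_dvd // => MP.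
have P_odd : odd (Phi 2 M).
  by apply: dvdn_odd PM _; rewrite -subn1 oddB ?expn_gt0 // oddX; case: (M) M0.
have [u uE] : exists u, gap k%:Z (Phi 2 M) = (u * M)%N.
  case/dvdnP: MP => u uE; case/dvdnP: Mk => v vE.
  exists `|u%:Z - v%:Z|%N; rewrite /gap.
  have -> : (Phi 2 M)%:Z - k%:Z = (Phi 2 M - 1)%N%:Z - k.-1%:Z by move: P0 k4; clear; lia.
  by rewrite uE vE !PoszM -mulrBl abszM.
have g_odd : odd (gap k%:Z (Phi 2 M)) by move: P_odd k_even; rewrite /gap; clear; lia.
have u2 : (2 < u)%N.
  move: g_odd gap_ne; rewrite uE oddM; clear; case: u => [|[|[|u]]] //.
  by rewrite mul1n.
have [Pbig _] := Phi_base2_prime_power i pr r2.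
have P2 : (2 < Phi 2 M)%N by apply: leq_trans Pbig; move: M2; rewrite -/M; clear; lia.
have uM : (6 < u * M)%N by apply: (@leq_trans (3 * 3)) => //; apply: leq_mul.
apply: (@seed_intro _ _ _ M u) => //; rewrite ?uE ?uM ?orbT //.
- exact: ltnW.
- exact: ltnW.
- exact: ltn_trans uM.
exact: Or32.
Qed.

(** If [k - 1] is a prime power, its cyclotomic value is a seed. Otherwise two distinct primes [r],
    [s] divide [k - 1]; if [2 ^ r - 1] and [2 ^ s - 1] both failed, they would lie at distances [r]
    and [s] from [k], too close to each other. *)
Lemma seed_base2 k : ~~ odd k -> (4 < k)%N -> exists n, seed 2 k%:Z n.
Proof.
move=> k_even k4; set K := k.-1.
have K4 : (4 < K)%N by rewrite /K; move: k_even k4; clear; case: k => [|[|[|[|[|[|k]]]]]].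
have K1 : (1 < K)%N by lia.
have K_odd : odd K by move: k_even; rewrite /K; case: (k) k4 => //= k' _; rewrite negbK.
have prime_gt2 r : prime r -> (r %| K)%N -> (2 < r)%N.
  by move=> pr rK; apply: odd_prime_gt2 => //; apply: dvdn_odd K_odd.
set r := pdiv K; have pr : prime r by apply: pdiv_prime.
have rK : (r %| K)%N by apply: pdiv_dvd.
have kE : k = K.+1 by rewrite /K prednK //; lia.
have [/p_natP[[|i] KE]|] := boolP (r.-nat K)%N; first by rewrite KE in K1.
  exists (Phi 2 (r ^ i.+1)); apply: seed_base2_prime_power => //.
  - by rewrite -/K KE.
  - exact: prime_gt2.
  rewrite -KE; have [_] := Phi_base2_prime_power i pr (prime_gt2 r pr rK).
  rewrite -KE => /(_ K4); rewrite /gap kE; move: (Phi _ _); clear; lia.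
rewrite /pnat (ltnW K1) /= => /allPn [s].
rewrite mem_primes => /and3P[ps _ sK]; rewrite inE /= => sr.
pose p0 (p : nat) := Phi 2 (p ^ 1).
have PE p : prime p -> p0 p = (2 ^ p).-1.
  by move=> pp; rewrite /p0 expn1 -[Phi 2 p]mul1n (@Phi_prime 2 p).
have H p : prime p -> (p %| K)%N -> gap k%:Z (p0 p) <> p -> exists n, seed 2 k%:Z n.
  move=> pp pK ne; exists (p0 p); apply: seed_base2_prime_power => //.
  exact: prime_gt2.
have [/eqP gr|/eqP] := boolP (gap k%:Z (p0 r) == r); last exact: H.
have [/eqP gs|/eqP] := boolP (gap k%:Z (p0 s) == s); last exact: H.
rewrite /gap !PE // in gr gs.
have far p q : (2 < p)%N -> (p < q)%N -> (2 ^ p + p + q < 2 ^ q)%N.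
  move=> p2; elim: q => // q IH; rewrite ltnS leq_eqVlt => /orP[/eqP <-|/IH].
    by rewrite expnS; have := ltn_linear_exp2 p2; move: (2 ^ p)%N; clear; lia.
  rewrite expnS; have := expn_gt0 2 p; move: (2 ^ p)%N (2 ^ q)%N; clear; lia.
have r2 := prime_gt2 _ pr rK; have s2 := prime_gt2 _ ps sK.
exfalso; case: (ltngtP r s) => [lt|lt|rs]; last by rewrite rs eqxx in sr.
  have := far _ _ r2 lt; have := ltn_pred_exp2 r2; move: gr gs; clear.
  by move: (2 ^ r)%N (2 ^ s)%N; lia.
have := far _ _ s2 lt; have := ltn_pred_exp2 s2; move: gr gs; clear.
by move: (2 ^ r)%N (2 ^ s)%N; lia.
Qed.

(** * Case analysis on [a] and [k] *)

Lemma solutions_explicit a k n j m B : (1 < a)%N ->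
  [&& 2 < n, power_test a j n, gap k n == m * j, 0 < j, 1 < m & 6 < m * j]%N ->
  exists2 x, (B < x)%N & solution a k x.
Proof.
move=> a1 /and5P[n2 nj /eqP gE j0 /andP[m1 mj]]; apply: (@seed_solutions a k n) => //.
apply: (@seed_intro a k n j m) => //; rewrite ?gE ?mj ?orbT //.
- exact: ltnW.
- exact: ltnW.
- exact: ltn_trans mj.
- exact: dvdn_power_test.
exact: Or32.
Qed.

Lemma solutions_base2 k B : k <> 0 -> exists2 m, (B < m)%N & solution 2 k m.
Proof.
move=> k0; have [k1|k1] := lerP 1 k.
  case: k k0 k1 => // k _ k1; have [k_odd|k_even] := boolP (odd k).
    by apply: coprime_solutions; rewrite ?coprime2n.
  have [k4|k4] := ltnP 4 k.
    by have [n sn] := seed_base2 k_even k4; apply: seed_solutions sn.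
  have [->|->] : k = 2%N \/ k = 4%N by move: k1 k_even k4; clear; case: k => [|[|[|[|[|]]]]]; auto.
    (* 89 divides [2 ^ 11 - 1], 233 divides [2 ^ 29 - 1], and [319 = 11 * 29]. *)
    by apply: (@solutions_explicit _ _ (89 * 233) 319 65); last by vm_compute.
  (* The orders of 2 modulo 7, 73 and 79 are 3, 9 and 39, with least common multiple 117. *)
  by apply: (@solutions_explicit _ _ (7 * 73 * 79) 117 345); last by vm_compute.
(* The seed 1 has gap [1 - k], which must exceed 6 at base 2; this leaves the values from -5 to
   -1. *)
have [k6|k6] := lerP k (- 6).
  apply: (@seed_solutions _ _ 1) => //; split=> //.
  - by exists 1%N; split=> //; rewrite ?dvd1n // /gap; move: k6; clear; lia.
  - by rewrite /gap; move: k6; clear; lia.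
  - by rewrite /gap; move: k6; clear; lia.
  - by apply: Or31; apply: le_lt_trans k6 _.
have [->|[->|[->|[->|->]]]] : k = -1 \/ k = -2 \/ k = -3 \/ k = -4 \/ k = -5 by lia.
- by apply: (@solutions_explicit _ _ 15 4 4); last by vm_compute.
- by apply: (@solutions_explicit _ _ 7 3 3); last by vm_compute.
- by apply: (@solutions_explicit _ _ 5 4 2); last by vm_compute.
- by apply: (@solutions_explicit _ _ 31 5 7); last by vm_compute.
- by apply: (@solutions_explicit _ _ 3 2 4); last by vm_compute.
Qed.

(** For odd [k] the seed is 2, and for even [k] it is 4, a divisor of [a ^ 2 - 1]. Their gaps are
    too small only for [k] in 1, 3 and in 2, 4, 6. These [k] are either coprime to [a], or [k] is 3
    or 6 with 3 dividing [a], where [a - 1] is a seed for large [a]. *)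
Lemma solutions_base_odd a k B : (2 < a)%N -> odd a ->
  exists2 m, (B < m)%N & solution a k m.
Proof.
move=> a2 a_odd; have a1 : (1 < a)%N by apply: ltnW.
have a_even : (2 %| a.-1)%N by rewrite dvdn2; case: (a) a1 a_odd => //= b _; rewrite negbK.
have cop1 (q : nat) : (0 < q)%N -> k = q%:Z -> coprime a q ->
    exists2 m, (B < m)%N & solution a k m.
  by move=> q0 -> aq; apply: coprime_solutions.
have a3 c : prime c -> ~~ coprime a c -> (c %| a)%N.
  by move=> pc; rewrite coprime_sym prime_coprime // negbK.
have [k_odd|k_even] := boolP (odd `|k|%N).
  have [k1|/eqP k1] := eqVneq k 1; first by apply: (cop1 1%N) => //; rewrite coprimen1.
  have [k3|/eqP k3] := eqVneq k 3; last first.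
    apply: (@seed_solutions _ _ 2) => //; apply: seed_of_order1 => //; last exact: Or33.
    by rewrite /gap; move: k_odd k1 k3; clear; lia.
  have [|/(a3 3%N isT) a3'] := boolP (coprime a 3); first exact: (cop1 3%N).
  have [a_3|a_ne] := eqVneq a 3%N.
    by rewrite a_3 k3; apply: (@solutions_explicit _ _ (17 * 547) 112 83); last by vm_compute.
  have a6 : (6 < a)%N.
    by move: a2 a_odd a_ne a3'; clear; case: a => [|[|[|[|[|[|[|]]]]]]].
  apply: (@seed_solutions _ _ a.-1) => //; apply: seed_of_order1 => //.
  - by move: a2; clear; lia.
  - by rewrite /gap k3; move: a6; clear; lia.
  - by apply: Or32; move: a6; clear; lia.
have [k2|/eqP k2] := eqVneq k 2; first by apply: (cop1 2%N) => //; rewrite coprimen2.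
have [k4|/eqP k4] := eqVneq k 4.
  by apply: (cop1 4%N) => //; apply: (@coprimeXr 2 a 2); rewrite coprimen2.
have [k6|/eqP k6] := eqVneq k 6; last first.
  apply: (@seed_solutions _ _ 4) => //.
  have gE : gap k 4 = ((gap k 4)./2 * 2)%N by rewrite /gap; move: k_even; clear; lia.
  have g4 : (4 <= gap k 4)%N by rewrite /gap; move: k_even k2 k4 k6; clear; lia.
  apply: (@seed_intro _ _ _ 2 (gap k 4)./2) => //.
  - exact: ltnW.
  - by move: g4; clear; lia.
  - exact: ltnW.
  - by rewrite a2.
  - case/dvdnP: a_even => b bE; have -> : a = (b * 2 + 1)%N by rewrite -bE; lia.
    by apply/dvdnP; exists (b ^ 2 + b)%N; rewrite -subn1 -mulnn; nia.
  - exact: Or32.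
have [a_6|] := boolP (coprime a 6); first exact: (cop1 6%N).
rewrite (@coprimeMr a 2 3) coprimen2 a_odd /= => /(a3 3%N isT) a3'.
have [a_3|a_ne3] := eqVneq a 3%N.
  by rewrite a_3 k6; apply: (@solutions_explicit _ _ 121 5 23); last by vm_compute.
have [a_9|a_ne9] := eqVneq a 9%N.
  by rewrite a_9 k6; apply: (@solutions_explicit _ _ 80 2 37); last by vm_compute.
have a10 : (10 < a)%N.
  by move: a2 a_odd a_ne3 a_ne9 a3'; clear; case: a => [|[|[|[|[|[|[|[|[|[|[|]]]]]]]]]]].
apply: (@seed_solutions _ _ a.-1) => //; apply: seed_of_order1 => //.
- by move: a2; clear; lia.
- by rewrite /gap k6; move: a10; clear; lia.
- by apply: Or32; move: a10; clear; lia.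
Qed.

(** The seed [a - 1] fails only for [k] from [a - 3] to [a + 1]. Then [a - 1] and [a + 1] are
    coprime to [a], [k = a - 3] uses [a ^ 2 - 1], and [k = a - 2] and [k = a] use the primitive part
    at the odd exponent [k - 1], small [a] apart. *)
Lemma solutions_base_even a k B : (2 < a)%N -> ~~ odd a ->
  exists2 m, (B < m)%N & solution a k m.
Proof.
move=> a2 a_even; have a1 : (1 < a)%N by apply: ltnW.
have a3 : (3 < a)%N by case: (a) a2 a_even => [|[|[|[|]]]].
have [g2|g2] := ltnP 2 (gap k a.-1).
  apply: (@seed_solutions _ _ a.-1) => //; apply: seed_of_order1 => //.
    by move: a3; clear; lia.
  by apply: Or32; move: a3; clear; lia.
have kE : k = (a - 3)%N%:Z \/ k = (a - 2)%N%:Z \/ k = (a - 1)%N%:Z \/ k = a%:Z \/ k = a.+1%:Z.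
  by move: g2 a3; rewrite /gap; clear; lia.
have consec (b : nat) : (0 < b)%N -> coprime a b -> k = b%:Z ->
    exists2 m, (B < m)%N & solution a k m.
  by move=> b0 ab ->; apply: coprime_solutions.
have primitive_case N : (4 < N)%N -> (N < a)%N -> odd N -> k = N.+1%:Z ->
    exists2 m, (B < m)%N & solution a k m.
  move=> N4 Na N_odd ->; have [q sq] := seed_of_primitive a2 N_odd N4 Na.
  exact: seed_solutions sq.
case: kE => [kE|[kE|[kE|[kE|kE]]]].
- apply: (@seed_solutions _ _ (a ^ 2).-1) => //.
  have sq : (a ^ 2 = a * a)%N by rewrite mulnn.
  have gE : gap k (a ^ 2).-1 = ((a * (a - 1) + 2)./2 * 2)%N.
    have : (a * (a - 1) + 2 = (a * (a - 1) + 2)./2 * 2)%N.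
      have : ~~ odd (a * (a - 1) + 2) by rewrite oddD oddM (negbTE a_even).
      by move: (_ + 2)%N; clear; lia.
    move=> <-; rewrite /gap kE sq; move: a3; clear; nia.
  have big : (6 < (a * (a - 1) + 2)./2 * 2)%N.
    have : (12 <= a * (a - 1))%N by apply: (@leq_mul 4 3); move: a3; clear; lia.
    by move: (a * _)%N; clear; lia.
  apply: (@seed_intro _ _ _ 2 _ _ _ gE) => //.
  + exact: ltnW.
  + by rewrite sq; move: a3; clear; nia.
  + by move: big; clear; lia.
  + by rewrite gE; apply: ltn_trans big.
  + by rewrite a2.
  + by apply: Or32; rewrite sq; move: a3; clear; nia.
- have [a4|a_ne4] := eqVneq a 4%N.
    by rewrite kE a4; apply: (@solutions_explicit _ _ 77 15 5); last by vm_compute.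
  have [a6|a_ne6] := eqVneq a 6%N.
    by rewrite kE a6; apply: (@solutions_explicit _ _ 43 3 13); last by vm_compute.
  by apply: (primitive_case (a - 3)%N); rewrite ?kE; move: a3 a_even a_ne4 a_ne6; clear; lia.
- apply: (consec a.-1); last by rewrite kE subn1.
    by move: a3; clear; lia.
  by rewrite coprimenP // ltnW.
- have [a4|a_ne4] := eqVneq a 4%N.
    by rewrite kE a4; apply: (@solutions_explicit _ _ (19 * 31) 45 13); last by vm_compute.
  by apply: (primitive_case (a - 1)%N); rewrite ?kE; move: a3 a_even a_ne4; clear; lia.
- by apply: (consec a.+1) => //; apply: coprimenS.
Qed.

Lemma solutions_unbounded a k B : (1 < a)%N -> ~ (k = 0 /\ a = 2%N) ->
  exists2 m, (B < m)%N & solution a k m.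
Proof.
rewrite leq_eqVlt => /orP[/eqP <-|a2] ka; first by apply: solutions_base2 => k0; apply: ka.
by have [a_odd|a_even] := boolP (odd a); [apply: solutions_base_odd | apply: solutions_base_even].
Qed.

(** * Transfer to integers and the excluded pair *)

Lemma eqz_mod1_pred (x n : nat) : (0 < x)%N -> (x%:Z = 1 %[mod n%:Z])%Z <-> (n %| x.-1)%N.
Proof.
move=> x0; have E : x%:Z - 1 = x.-1%:Z by rewrite -(prednK x0) /=; lia.
by split=> [/eqP|nx]; [|apply/eqP]; rewrite eqz_mod_dvd E dvdzE.
Qed.

Lemma solution_expz_modeq a k n : (0 < a)%N -> solution a k n ->
  expz_modeq n%:Z a%:Z (n%:Z - k) 1.
Proof.
move=> a0 [n0]; rewrite /gap; have X m : (a%:Z ^+ m = (a ^ m)%N%:Z) by rewrite -!natz natrX.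
have Y m : (0 < a ^ m)%N by rewrite expn_gt0 a0.
case: (n%:Z - k) => m /=; rewrite /expz_modeq; first by rewrite X => nm; apply/eqz_mod1_pred.
(* [Negz m] is [- (m + 1)] and [a ^ (m + 1)] is 1 modulo [n], so [a ^ m] is an inverse of [a]. *)
move=> nm; exists (a%:Z ^+ m).
  by rewrite -exprS X; apply/eqz_mod1_pred.
rewrite -exprM X; apply/eqz_mod1_pred => //; apply: dvdn_trans nm _.
by rewrite mulnC expnM dvdn_pred_predX.
Qed.

Lemma infinite_set_unbounded (A : set int) :
  (forall B : nat, exists2 m : nat, (B < m)%N & A m%:Z) -> infinite_set A.
Proof.
move=> H /finite_seqP [s As]; have [m Bm] := H (\sum_(x <- s) `|x|)%N.
rewrite As /= => ms; move: Bm; rewrite ltnNge (big_rem _ ms) /=.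
by rewrite leq_addr.
Qed.

(** Let [p] be the least prime factor of [n]. Then [n] and [p - 1] are coprime, so if [p] divided
    [2 ^ n - 1] it would, by Fermat, divide [2 ^ 1 - 1]. *)
Lemma not_dvdn_pred_exp2 n : (1 < n)%N -> ~~ (n %| (2 ^ n).-1)%N.
Proof.
move=> n1; apply/negP => nP; have pp := pdiv_prime n1; have n0 := ltnW n1.
have pn := dvdn_trans (pdiv_dvd n) nP.
have := pred_expn_gcd (isT : 0 < 2)%N n0 pn (fermat_pred pp (isT : 0 < 2)%N n0 pn).
suff -> : gcdn n (pdiv n).-1 = 1%N by rewrite dvdn1 => /eqP p1; rewrite p1 in pp.
have p10 : (0 < (pdiv n).-1)%N by rewrite -ltnS prednK ?pdiv_gt0 // prime_gt1.
apply/eqP; rewrite eqn_leq gcdn_gt0 n0 andbT leqNgt; apply/negP => g1.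
have := pdiv_min_dvd g1 (dvdn_gcdl _ _); apply/negP; rewrite -ltnNge.
by rewrite -[X in (_ < X)%N](prednK (pdiv_gt0 n)) ltnS dvdn_leq // dvdn_gcdr.
Qed.

Theorem theorem7p3 (a k : int) (ha : 2 <= a) :
  ((k, a) <> (0, 2) ->
    infinite_set [set n : int | 0 < n /\ expz_modeq n a (n - k) 1]) /\
  ((k, a) = (0, 2) ->
    ~ exists n : int, 1 < n /\ expz_modeq n a (n - k) 1).
Proof.
case: a ha => // a ha; split=> [ka | [-> ->]].
  apply: infinite_set_unbounded => B.
  have [|m Bm sm] := @solutions_unbounded a k B ha.
    by case=> k0 a2; apply: ka; rewrite k0 a2.
  by exists m => //=; split; [case: sm | apply: solution_expz_modeq => //; apply: ltnW].
case=> [[n|n]] [n1] //; rewrite subr0 /=.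
have -> : (2%:Z ^+ n = (2 ^ n)%N%:Z) by rewrite -!natz natrX.
by move/eqz_mod1_pred => /(_ (expn_gt0 2 n)); apply/negP/not_dvdn_pred_exp2.
Qed.
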